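(* Let $\mathcal{G}$ be the class of all finite groups. The set $$\operatorname{Im}\psi''=\lbrace \psi''(G) \mid G\in\mathcal{G}\rbrace$$ is dense in $[0,1]$.
   Context: For a finite group $G$ and $x\in G$, $o(x)$ denotes the order of $x$. The sum of element orders of $G$ is $\psi(G)=\sum_{x\in G}o(x)$, and $\psi''(G)=\frac{\psi(G)}{|G|^2}$. One has $\psi''(G)\in(0,1]$ for every finite group $G$. Density in $[0,1]$ is with respect to the usual topology of $\mathbb{R}$, i.e. the closure of the set is $[0,1]$. *)

(* Defs.v *)
From HB Require Import structures.
From mathcomp Require Import all_boot all_order all_algebra all_fingroup.
From mathcomp Require Import all_classical all_reals all_analysis.
Import numFieldNormedType.Exports.

Set Implicit Arguments.
Unset Strict Implicit.
Unset Printing Implicit Defensive.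

Local Open Scope ring_scope.
Local Open Scope classical_set_scope.

Definition psi (gT : finGroupType) (G : {group gT}) : nat :=
  (\sum_(x in G) #[x]%g)%N.

Definition psi'' (R : realType) (gT : finGroupType) (G : {group gT}) : R :=
  (psi G)%:R / #|G|%:R ^+ 2.

(* The image of psi'' on the class of all finite groups: each finite group is a
   full group [set: gT], and a subgroup G of gT is itself a finite group. *)
Definition Im_psi'' (R : realType) : set R :=
  [set r | exists (gT : finGroupType) (G : {group gT}), r = psi'' R G].

Arguments Im_psi'' R : clear implicits.

(* Main.v *)
(** On groups of coprime orders psi'' is multiplicative, and a group of prime
    order p has psi'' = 1 - 1/p + 1/p^2 =: a_p. Hence the product of the a_p
    over the primes m <= p < n is a value of psi''. For fixed m it starts from
    1 and tends to 0 as n grows: a_p ^ 2 <= 1 - 1/p for p >= 3, and by Euler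
    the product of the 1 - 1/p vanishes because the harmonic series diverges.
    Since a_p > 1 - 1/m for all p >= m, the relative steps of this decreasing
    sequence are as small as desired, so it comes close to every point
    of [0, 1]. *)

Require Import Defs.
From HB Require Import structures.
From mathcomp Require Import all_boot all_order all_algebra all_fingroup.
From mathcomp Require Import all_classical all_reals all_analysis.
From mathcomp Require Import cyclic ring lra.
Import numFieldNormedType.Exports.
Import Order.TTheory GRing.Theory Num.Theory.

Local Open Scope ring_scope.
Local Open Scope classical_set_scope.

(** The elements [(x, 1)] and [(1, y)] commute and have coprime orders. *)
Lemma order_pair (gT1 gT2 : finGroupType) (x : gT1) (y : gT2) :
  coprime #[x]%g #[y]%g -> #[(x, y)]%g = (#[x]%g * #[y]%g)%N.
Proof.
move=> co_xy; have -> : (x, y) = (pairg1 gT2 x * pair1g gT1 y)%g.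
  by congr (_, _); rewrite ?mulg1 ?mul1g.
have ox : #[pairg1 gT2 x]%g = #[x]%g by rewrite order_injm ?injm_pairg1 ?inE.
have oy : #[pair1g gT1 y]%g = #[y]%g by rewrite order_injm ?injm_pair1g ?inE.
rewrite orderM ?ox ?oy //.
by congr (_, _); rewrite /= ?mulg1 ?mul1g.
Qed.

Lemma psi_setX (gT1 gT2 : finGroupType) (G : {group gT1}) (H : {group gT2}) :
  coprime #|G| #|H| -> psi (setX_group G H) = (psi G * psi H)%N.
Proof.
move=> coGH; rewrite /psi big_distrlr /= pair_big /=.
apply: eq_big => [[x y]|[x y]] /=; first by rewrite finset.in_setX.
rewrite finset.in_setX => /andP[xG yH].
by rewrite order_pair // (coprimegS _ (coprimeSg _ coGH)) ?cycle_subG.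
Qed.

Lemma psi''_setX (R : realType) (gT1 gT2 : finGroupType)
    (G : {group gT1}) (H : {group gT2}) : coprime #|G| #|H| ->
  psi'' R (setX_group G H) = psi'' R G * psi'' R H.
Proof.
move=> coGH; rewrite /psi'' psi_setX //= cardsX !natrM exprMn invfM.
by rewrite mulrACA.
Qed.

Lemma psi_prime (gT : finGroupType) (G : {group gT}) :
  prime #|G| -> psi G = (1 + #|G|.-1 * #|G|)%N.
Proof.
move=> pr_G; rewrite /psi (big_setD1 1%g) ?group1 //= order1; congr (_ + _)%N.
rewrite (eq_bigr (fun _ => #|G|)) => [|x /setD1P[nt_x xG]].
  by rewrite sum_nat_const (cardsD1 1%g G) group1.
have /primeP[_ /(_ _ (order_dvdG xG))] := pr_G.
by rewrite order_eq1 (negPf nt_x) => /eqP.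
Qed.

Lemma psi''_prime (R : realType) (gT : finGroupType) (G : {group gT}) :
  prime #|G| -> psi'' R G = 1 - #|G|%:R^-1 + #|G|%:R^-1 ^+ 2.
Proof.
move=> pr_G; rewrite /psi'' psi_prime // natrD natrM -subn1 natrB ?prime_gt0 //.
have : #|G|%:R != 0 :> R by rewrite pnatr_eq0 -lt0n prime_gt0.
by move=> nz; field.
Qed.

Lemma psi''_ge0 (R : realType) (gT : finGroupType) (G : {group gT}) :
  0 <= psi'' R G.
Proof. by rewrite /psi'' divr_ge0 ?exprn_ge0. Qed.

Lemma psi''_le1 (R : realType) (gT : finGroupType) (G : {group gT}) :
  psi'' R G <= 1.
Proof.
rewrite /psi'' ler_pdivrMr ?exprn_gt0 ?ltr0n ?cardG_gt0 // mul1r -natrX ler_nat.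
rewrite /psi -mulnn -sum_nat_const leq_sum // => x xG.
by rewrite dvdn_leq ?cardG_gt0 ?order_dvdG.
Qed.

Lemma prime_prod_Im_psi'' (R : realType) (m n : nat) :
  Im_psi'' R (\prod_(m <= p < n | prime p) (1 - p%:R^-1 + p%:R^-1 ^+ 2)).
Proof.
(* The induction also records that all prime divisors of [#|G|] are below [n]: this makes [#|G|]
   coprime to the next prime, so a cyclic factor of that order can be adjoined. *)
suff [gT [G [-> _]]] : exists (gT : finGroupType) (G : {group gT}),
    \prod_(m <= p < n | prime p) (1 - p%:R^-1 + p%:R^-1 ^+ 2) = psi'' R G
    /\ [pred p | p < n]%N.-nat #|G|.
  by exists gT, G.
elim: n => [|n [gT [G [IHpsi IHpi]]]].
  exists 'Z_2, 1%G; rewrite big_geq // cards1; split=> //.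
  by rewrite /psi'' /psi big_set1 order1 cards1 expr1n divr1.
have piS : [pred p | p < n.+1]%N.-nat #|G|.
  by apply: sub_in_pnat IHpi => p _; rewrite !inE => /ltnW.
have [lt_nm|le_mn] := ltnP n m.
  by exists gT, G; rewrite -IHpsi !big_geq // ltnW.
rewrite big_mkcond big_nat_recr //= -big_mkcond IHpsi.
case: ifP => [pr_n|_]; last by exists gT, G; rewrite mulr1.
have oZ : #|Zp n| = n by rewrite card_Zp ?prime_gt0.
have co : coprime #|G| #|Zp n|.
  rewrite oZ coprime_sym prime_coprime //; apply/negP => n_dvd.
  by have /(pnatP _ (cardG_gt0 G))/(_ n pr_n n_dvd) := IHpi;
    rewrite /= inE ltnn.
exists (gT * 'Z_n)%type, (setX_group G (Zp_group n)); split.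
  by rewrite psi''_setX // [psi'' R (Zp_group n)]psi''_prime oZ.
by rewrite cardsX pnatM piS oZ pnatE //= !inE ltnSn.
Qed.

(* k = 0 does not contribute: [pi.-nat k] requires k > 0. *)
Definition smooth_harmonic (R : realType) (n m : nat) : R :=
  \sum_(k < n | [pred p | p < m]%N.-nat k) k%:R^-1.

Lemma pnat_ltS (m k : nat) : ~~ (prime m && (m %| k)%N) ->
  [pred p | p < m.+1]%N.-nat k = [pred p | p < m]%N.-nat k.
Proof.
move=> m_k; apply/idP/idP; last first.
  by apply: sub_in_pnat => p _; rewrite !inE => /ltnW.
move=> pi_k; apply: sub_in_pnat (pi_k) => p; rewrite mem_primes !inE.
move=> /and3P[pr_p _ p_k]; rewrite ltnS leq_eqVlt => /predU1P[p_m|//].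
by rewrite -p_m pr_p p_k in m_k.
Qed.

(* The m.+1-smooth k are either m-smooth, or k = m * j with j again
   m.+1-smooth; the latter contribute at most 1/m times the left-hand sum. *)
Lemma smooth_harmonicS_prime (R : realType) (n m : nat) : prime m ->
  smooth_harmonic R n m.+1 * (1 - m%:R^-1) <= smooth_harmonic R n m.
Proof.
move=> pr_m; rewrite mulrBr mulr1 lerBlDr {1}/smooth_harmonic.
case: n => [|n]; first by rewrite /smooth_harmonic !big_ord0 mul0r addr0.
rewrite (bigID (fun k : 'I_n.+1 => (m %| k)%N)) /= addrC lerD //.
  rewrite [leLHS]big_mkcond [leRHS]big_mkcond ler_sum //= => k _.
  have [m_k|/= m_k] := boolP (m %| k)%N; last by rewrite andbT pnat_ltS ?pr_m.
  by rewrite andbF; case: ifP.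
(* Substitute [k = m * j]. *)
rewrite (reindex_onto (fun j : 'I_n.+1 => inord (m * j) : 'I_n.+1)
                      (fun k : 'I_n.+1 => inord (k %/ m) : 'I_n.+1)) /=;
  last first.
  move=> k /andP[_ m_k]; apply: val_inj; rewrite /= [X in (m * X)%N]inordK.
    by rewrite mulnC divnK ?inordK.
  by rewrite (leq_ltn_trans (leq_div _ _)).
rewrite /smooth_harmonic mulr_suml [leLHS]big_mkcond [leRHS]big_mkcond.
rewrite ler_sum //= => j _.
case: ifP => [/andP[/andP[pi_mj m_mj] /eqP def_j]|_]; last first.
  by case: ifP => // _; rewrite mulr_ge0 ?invr_ge0.
have [lt_mj|le_mj] := ltnP (m * j) n.+1.
  move: pi_mj; rewrite inordK // pnatM => /andP[_ ->].
  by rewrite natrM invfM mulrC.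
(* When [m * j] is out of range, [inord] returns 0, which is not smooth. *)
by move: pi_mj; rewrite /inord /insubd insubF //= ltnNge le_mj.
Qed.

(** Finite form of Euler's product: each new prime increases the smooth sum by at most the factor
    that the product compensates. *)
Lemma smooth_harmonic_prod_le1 (R : realType) (n m : nat) :
  smooth_harmonic R n m * \prod_(0 <= p < m | prime p) (1 - p%:R^-1) <= 1.
Proof.
elim: m => [|m IHm].
  rewrite big_geq // mulr1.
  (* Only 1 has all its prime factors below 0. *)
  apply: (@le_trans _ _ (\sum_(k < n | k == 1%N :> nat) k%:R^-1)).
    rewrite /smooth_harmonic [leLHS]big_mkcond [leRHS]big_mkcond.
    rewrite ler_sum //= => k _.
    case: ifP => [|_]; last by case: ifP => // _; rewrite invr_ge0.
    move=> pi_k; have -> : k = 1%N :> nat; last by rewrite eqxx.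
    apply: (pnat_1 pi_k); apply: sub_in_pnat pi_k => p _.
    by rewrite !inE.
  have /= -> := big_ord1_eq +%R (fun k => k%:R^-1 : R) 1%N n.
  by rewrite invr1; case: ifP.
apply: le_trans IHm; rewrite big_mkcond big_nat_recr //= -big_mkcond.
have prod_ge0 : 0 <= \prod_(0 <= p < m | prime p) (1 - p%:R^-1) :> R.
  apply: prodr_ge0 => p /prime_gt0 p_gt0.
  by rewrite subr_ge0 invf_le1 ?ltr0n // ler1n.
case: ifP => [pr_m|nonprime_m].
  by rewrite mulrCA mulrC ler_wpM2r // smooth_harmonicS_prime.
rewrite mulr1 ler_wpM2r // /smooth_harmonic le_eqVlt; apply/orP; left.
by apply/eqP/eq_bigl => k; rewrite pnat_ltS // nonprime_m.
Qed.

(** Every [k] with 0 < k <= n is [n.+1]-smooth. The indices shift by one because [harmonic k] is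
    1/(k+1). *)
Lemma smooth_harmonic_diag (R : realType) (n : nat) :
  smooth_harmonic R n.+1 n.+1 = series harmonic n.
Proof.
rewrite /smooth_harmonic big_mkcond big_ord_recl /= add0r /series /= big_mkord.
apply: eq_bigr => k _; rewrite /bump /= add1n ifT //.
apply/pnatP => // p _ p_k.
by rewrite !inE ltnS (leq_trans (dvdn_leq _ p_k)).
Qed.

Lemma harmonic_unbounded (R : realType) (A : R) :
  exists n, A < series harmonic n.
Proof.
have : series (@harmonic R) @ \oo --> +oo%R.
  apply: nondecreasing_dvgn_lt; last exact: dvg_harmonic.
  by apply: nondecreasing_series => k _ _; apply: harmonic_ge0.
by move=> /cvgryPgt/(_ A)/filter_ex.
Qed.

(** With x = 1/p, right minus left is x(1 - 3x + x^2(2 - x)), nonnegative for 0 < x <= 1/3. The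
    inequality fails at p = 2. *)
Lemma prime_factor_sq_le (R : realType) (p : nat) : (2 < p)%N ->
  (1 - p%:R^-1 + p%:R^-1 ^+ 2) ^+ 2 <= 1 - p%:R^-1 :> R.
Proof.
move=> p_gt2; set x : R := p%:R^-1.
have x_gt0 : 0 < x by rewrite invr_gt0 ltr0n (ltn_trans _ p_gt2).
have x_le : x <= 3^-1.
  by rewrite lef_pV2 ?posrE ?ltr0n ?ler_nat // (ltn_trans _ p_gt2).
nra.
Qed.

Lemma prime_prod_small (R : realType) (m : nat) (e : R) : (2 < m)%N -> 0 < e ->
  exists n, \prod_(m <= p < n | prime p) (1 - p%:R^-1 + p%:R^-1 ^+ 2) < e.
Proof.
move=> m_gt2 e_gt0.
have fac_gt0 p : prime p -> 0 < 1 - p%:R^-1 :> R.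
  by move=> pr_p; rewrite subr_gt0 invf_lt1 ?ltr0n ?ltr1n ?prime_gt0 ?prime_gt1.
pose C : R := \prod_(0 <= p < m | prime p) (1 - p%:R^-1).
have C_gt0 : 0 < C by apply: prodr_gt0.
have [n lt_n] := harmonic_unbounded R (C * e ^+ 2)^-1.
(* [N] must keep the harmonic sum large and let the product be split at [m]. *)
have [N le_nN le_mN] : exists2 N, (n <= N)%N & (m <= N.+1)%N.
  by exists (maxn m n); rewrite ?leq_maxr // ltnW // ltnS leq_maxl.
exists N.+1; set P : R := \prod_(m <= p < N.+1 | prime p) _.
have P_ge0 : 0 <= P.
  apply: prodr_ge0 => p _.
  move: p%:R^-1 => x.
  have -> : 1 - x + x ^+ 2 = (x - 2^-1) ^+ 2 + 3 / 4 by field.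
  by rewrite addr_ge0 ?sqr_ge0 ?divr_ge0.
pose Q : R := \prod_(m <= p < N.+1 | prime p) (1 - p%:R^-1).
have le_sq : P ^+ 2 <= Q.
  rewrite /P /Q -prodrXl big_nat_cond [leRHS]big_nat_cond.
  apply: ler_prod => p /andP[/andP[le_mp _] pr_p].
  by rewrite sqr_ge0 prime_factor_sq_le // (leq_trans m_gt2).
have split_C : \prod_(0 <= p < N.+1 | prime p) (1 - p%:R^-1) = C * Q.
  by rewrite (big_cat_nat (leq0n m) le_mN).
have := smooth_harmonic_prod_le1 R N.+1 N.+1.
rewrite split_C smooth_harmonic_diag.
have le_series : series harmonic n <= series (@harmonic R) N.
  by apply: nondecreasing_series le_nN => k _ _; apply: harmonic_ge0.
apply: contraTT; rewrite -leNgt -ltNge => le_eP.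
have Ce_gt0 : 0 < C * e ^+ 2 by rewrite mulr_gt0 ?exprn_gt0.
have lt_N := lt_le_trans lt_n le_series.
(* If e <= P, then with H the harmonic sum up to [N], 1 < H C e^2 <= H C P^2 <= H C Q, against
   Euler's bound. *)
rewrite -[ltLHS](mulVf (lt0r_neq0 Ce_gt0)).
apply: (@lt_le_trans _ _ (series harmonic N * (C * e ^+ 2))).
  by rewrite ltr_pM2r.
rewrite ler_pM2l ?(lt_trans _ lt_N) ?invr_gt0 // ler_pM2l //.
by apply: le_trans le_sq; rewrite ler_pXn2r ?nnegrE // ltW.
Qed.

Theorem theorem1p1 (R : realType) : closure (Im_psi'' R) = `[0, 1].
Proof.
rewrite eqEsubset; split.
  have /closure_id -> : closed (`[0, 1] : set R) by exact: interval_closed.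
  apply: closure_subset => _ [gT [G ->]].
  by rewrite /= in_itv /= psi''_ge0 psi''_le1.
move=> t; rewrite /= in_itv /= => /andP[t_ge0 t_le1] B.
move=> /nbhs_ballP[e /= e_gt0 sB].
(* The bound 3 serves [prime_prod_small]; the other gives (1 + e)/k < e for all k >= m. *)
pose m := maxn 3 (Num.bound ((1 + e) / e)).
pose P n : R := \prod_(m <= p < n | prime p) (1 - p%:R^-1 + p%:R^-1 ^+ 2).
have exP : exists n, P n < t + e.
  have [n lt_n] := prime_prod_small R m e (leq_maxl _ _) e_gt0.
  by exists n; rewrite (lt_le_trans lt_n) // lerDr.
(* At the first [n] where the product drops below t + e, it cannot have jumped past t - e. *)
case: (ex_minnP exP) => n lt_n min_n.
suff lt_t : t - e < P n.
  exists (P n); split; first exact: prime_prod_Im_psi''.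
  by apply: sB; rewrite /ball /= ltr_distlC lt_t lt_n.
have [le_nm|lt_mn] := leqP n m.
  by rewrite /P big_geq // ltrBlDr (le_lt_trans t_le1) // ltrDl.
case: n lt_mn lt_n min_n => // k le_mk lt_n min_k.
have le_k : t + e <= P k.
  by rewrite leNgt; apply/negP => /min_k; rewrite ltnn.
move: lt_n; rewrite /P big_mkcond big_nat_recr //= -big_mkcond -/(P k).
(* At a nonprime [k] the product would not change, so it could not have dropped below t + e. *)
case: ifP => [pr_k _|_]; last by rewrite mulr1 ltNge le_k.
have k_gt : (1 + e) / e < k%:R.
  apply: lt_le_trans (archi_boundP _) _.
    by rewrite divr_ge0 ?addr_ge0 ?ltW.
  by rewrite ler_nat (leq_trans (leq_maxr _ _) le_mk).
have k_gt0 : 0 < k%:R :> R by rewrite ltr0n prime_gt0.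
have kV_lt : k%:R^-1 * (1 + e) < e.
  by rewrite mulrC ltr_pdivrMr // mulrC -ltr_pdivrMr.
have kV_gt0 : 0 < k%:R^-1 :> R by rewrite invr_gt0.
have kV_le1 : k%:R^-1 <= 1 :> R by rewrite invf_le1 // ler1n prime_gt0.
move: k%:R^-1 (P k) kV_lt kV_gt0 kV_le1 le_k => x y kV_lt kV_gt0 kV_le1 le_y.
(* Since t <= 1, x(t + e) <= x(1 + e) < e < 2e. *)
have lt1 : t - e < (t + e) * (1 - x) by nra.
rewrite (lt_le_trans lt1) //.
apply: (@le_trans _ _ (y * (1 - x))); first by rewrite ler_wpM2r // subr_ge0.
rewrite ler_wpM2l ?lerDl ?sqr_ge0 //.
by rewrite (le_trans _ le_y) // addr_ge0 // ltW.
Qed.
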